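(* For every integer $m\ge 2$, the line graph $L(\Gamma(\mathbb{Z}_{2^m}[i]))$ is pancyclic.
   Context: $\mathbb{Z}_n[i]=\mathbb{Z}[i]/\langle n\rangle=\{a+bi : a,b\in\mathbb{Z}_n\}$ with $i^2=-1$. For a finite commutative ring $R$ with unity, $\Gamma(R)$ has vertex set the nonzero zero-divisors of $R$, distinct $x,y$ adjacent iff $xy=0$. The line graph $L(G)$ has the edges of $G$ as vertices, two being adjacent iff they share an endpoint in $G$. A graph of order $N$ is pancyclic if $N\ge 3$ and it contains a cycle of length $k$ for every $3\le k\le N$. *)

(* Defs.v *)
From HB Require Import structures.
From mathcomp Require Import all_boot all_order all_algebra.
From mathcomp Require Import ring.

Set Implicit Arguments.
Unset Strict Implicit.
Unset Printing Implicit Defensive.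

Import GRing.Theory.
Local Open Scope ring_scope.

(* ['Z_n] is the ring of integers modulo n only for [1 < n]. *)
Record gaussZ (n : nat) : Type := GaussZ { gre : 'Z_n; gim : 'Z_n }.

Section GaussZ.
Variable n : nat.
Implicit Types x y z : gaussZ n.

Definition pair_of_gaussZ x : 'Z_n * 'Z_n := (gre x, gim x).
Definition gaussZ_of_pair (p : 'Z_n * 'Z_n) : gaussZ n := GaussZ p.1 p.2.

Lemma pair_of_gaussZK : cancel pair_of_gaussZ gaussZ_of_pair.
Proof. by case. Qed.

HB.instance Definition _ := Finite.copy (gaussZ n) (can_type pair_of_gaussZK).

Definition gadd x y := GaussZ (gre x + gre y) (gim x + gim y).
Definition gopp x := GaussZ (- gre x) (- gim x).
Definition gmul x y :=
  GaussZ (gre x * gre y - gim x * gim y) (gre x * gim y + gim x * gre y).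

Lemma gaddA : associative gadd.
Proof. by move=> x y z; rewrite /gadd /= !addrA. Qed.
Lemma gaddC : commutative gadd.
Proof. by move=> x y; congr GaussZ; rewrite addrC. Qed.
Lemma gadd0 : left_id (GaussZ 0 0 : gaussZ n) gadd.
Proof. by case=> a b; rewrite /gadd /= !add0r. Qed.
Lemma gaddN : left_inverse (GaussZ 0 0 : gaussZ n) gopp gadd.
Proof. by move=> x; rewrite /gadd /= !addNr. Qed.

HB.instance Definition _ :=
  GRing.isZmodule.Build (gaussZ n) gaddA gaddC gadd0 gaddN.

Lemma gmulA : associative gmul.
Proof. by move=> x y z; congr GaussZ => /=; ring. Qed.
Lemma gmulC : commutative gmul.
Proof. by move=> x y; congr GaussZ => /=; ring. Qed.
Lemma gmul1 : left_id (GaussZ 1 0 : gaussZ n) gmul.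
Proof. by case=> a b; congr GaussZ => /=; ring. Qed.
Lemma gmulDl : left_distributive gmul gadd.
Proof. by move=> x y z; congr GaussZ => /=; ring. Qed.
Lemma gone_neq0 : (GaussZ 1 0 : gaussZ n) != 0.
Proof. by apply/eqP => -[]. Qed.

HB.instance Definition _ :=
  GRing.Zmodule_isComNzRing.Build (gaussZ n) gmulA gmulC gmul1 gmulDl gone_neq0.

End GaussZ.

Record sgraph : Type := SGraph {
  vertex :> finType;
  adj : rel vertex;
  adj_sym : symmetric adj;
  adj_irrefl : irreflexive adj }.

Section ZeroDivisorGraph.
Variable R : finComNzRingType.

Definition zero_divisor (x : R) : bool := [exists y : R, (y != 0) && (x * y == 0)].

Definition zdvertex : finType := {x : R | (x != 0) && zero_divisor x}.

Definition zdadj : rel zdvertex :=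
  fun x y => (x != y) && (val x * val y == 0).

Lemma zdadj_sym : symmetric zdadj.
Proof. by move=> x y; rewrite /zdadj eq_sym mulrC. Qed.
Lemma zdadj_irrefl : irreflexive zdadj.
Proof. by move=> x; rewrite /zdadj eqxx. Qed.

Definition zero_divisor_graph : sgraph := SGraph zdadj_sym zdadj_irrefl.

End ZeroDivisorGraph.

Section LineGraph.
Variable G : sgraph.

Definition is_edge (e : {set G}) : bool :=
  [exists x : G, exists y : G, adj x y && (e == [set x; y])].

Definition edge : finType := {e : {set G} | is_edge e}.

Definition line_adj : rel edge :=
  fun e f => (e != f) && [exists x : G, (x \in val e) && (x \in val f)].

Lemma line_adj_sym : symmetric line_adj.
Proof.
move=> e f; rewrite /line_adj eq_sym; congr (_ && _).
by apply: eq_existsb => x; rewrite andbC.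
Qed.
Lemma line_adj_irrefl : irreflexive line_adj.
Proof. by move=> e; rewrite /line_adj eqxx. Qed.

Definition line_graph : sgraph := SGraph line_adj_sym line_adj_irrefl.

End LineGraph.

(* [ucycle] also accepts closed walks of size at most 2, hence [2 < k]. *)
Definition has_cycle (G : sgraph) (k : nat) : Prop :=
  (2 < k)%N /\ exists c : seq G, ucycle (@adj G) c /\ size c = k.

Definition pancyclic (G : sgraph) : Prop :=
  (3 <= #|G|)%N /\ forall k : nat, (3 <= k <= #|G|)%N -> has_cycle G k.

(* Main.v *)
Require Import Defs.
From HB Require Import structures.
From mathcomp Require Import all_boot all_order all_algebra.
From mathcomp Require Import ring zify.

(** The nonzero [x] whose norm [a^2 + b^2] vanishes mod [2^m] form a clique of
    the zero-divisor graph that meets every edge: by multiplicativity of the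
    norm on lifts to [Z[i]], [2^(2m)] divides [N(x) N(y)] as soon as [xy = 0],
    and conversely [4^m | u^2 + v^2] forces [2^m | u] and [2^m | v].
    In any graph, the edges of a cycle on [k >= 3] vertices of a clique form a
    [k]-cycle of the line graph.  Starting from a cycle on the whole clique
    [K], all remaining edges can be inserted one at a time: every [a] in [K]
    lies on two consecutive edges of the current cycle, any edge at [a] can be
    placed between them, and this leaves the consecutive pairs of the other
    vertices of [K] untouched, two distinct edges sharing at most one vertex. *)

Set Implicit Arguments.
Unset Strict Implicit.
Unset Printing Implicit Defensive.

Import GRing.Theory.

(** * Successors in duplicate-free cyclic sequences *)

Lemma next_next_neq (T : eqType) (s : seq T) (x : T) :
  uniq s -> (2 < size s)%N -> x \in s -> next s (next s x) != x.
Proof.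
move=> us s3 xs; have [i r Er] := rot_to xs.
rewrite -!(next_rot i us) Er.
have := us; rewrite -(rot_uniq i) Er; have := s3; rewrite -(size_rot i) Er.
case: r {Er} => [|y [|z r]] //= _ /and3P[]; rewrite eqxx !inE !negb_or.
move=> /and3P[xy xz _] _ _; rewrite [y == x]eq_sym (negbTE xy) eqxx.
by rewrite eq_sym.
Qed.

Lemma next_map_in (T U : eqType) (f : T -> U) (s : seq T) (x : T) :
  uniq s -> uniq (map f s) -> x \in s ->
  next (map f s) (f x) = f (next s x).
Proof.
move=> us ufs xs; have [i r Er] := rot_to xs.
rewrite -(next_rot i us) -(next_rot i ufs) -map_rot Er.
by case: r {Er} => [|y r] /=; rewrite !eqxx.
Qed.

Lemma cycle_next_rel (T : eqType) (e : rel T) (s : seq T) :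
  uniq s -> (forall x, x \in s -> e x (next s x)) -> cycle e s.
Proof.
move=> us H; apply: (sub_in_cycle (P := mem s)) (cycle_next us); last first.
  by apply/allP.
by move=> x y xs _ /= /eqP <-; apply: H.
Qed.

(** * Inserting one edge into a cycle of edges *)

Section Insertion.
(* Stated for an abstract incidence relation: conversion tests between elements
   of the concrete type of edges may diverge. *)
Variables (V E : eqType) (inc : V -> E -> bool) (l : rel E).
Hypothesis l_irr : irreflexive l.
Hypothesis l_inc : forall e f x, e != f -> inc x e -> inc x f -> l e f.
Hypothesis inc_eq2 : forall e f x y,
  x != y -> inc x e -> inc y e -> inc x f -> inc y f -> e = f.
Implicit Types (a b : V) (e f g : E) (c : seq E) (K : seq V).

Definition passes_through K c :=
  forall a, a \in K -> exists2 e, e \in c & inc a e && inc a (next c e).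

Lemma passes_through_rot K c i :
  uniq c -> passes_through K c -> passes_through K (rot i c).
Proof.
move=> uc H a /H[e ec h]; exists e; first by rewrite mem_rot.
by rewrite next_rot.
Qed.

Lemma insert_edge K c g : (1 < size c)%N -> (exists2 a, a \in K & inc a g) ->
  ucycle l c -> passes_through K c -> g \notin c ->
  exists c', [/\ ucycle l c', size c' = (size c).+1
                & passes_through K c'].
Proof.
move=> c2 [a aK ag] /andP[cyc uc] pc gc.
have [e ec /andP[ae af]] := pc a aK.
(* With [e] rotated to the front, the insertion takes place right after the head, away from the
   wrap-around. *)
have [i r Er] := rot_to ec.
move: pc => /(passes_through_rot i uc); rewrite -(next_rot i uc) in af.
rewrite -(rot_cycle i) in cyc; rewrite -(rot_uniq i) in uc.
rewrite -(mem_rot i) in gc; rewrite -(size_rot i) in c2 *.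
rewrite Er in cyc uc gc af c2 * => {ec Er}.
case: r cyc uc gc af c2 => // f r; rewrite /= eqxx.
move=> /andP[aef cyc] uc gc af _ pc.
move: (gc); rewrite !inE !negb_or => /and3P[ge gf gr].
exists [:: e, g, f & r]; split; [|by []|].
  apply/andP; split; last first.
    by move: uc; rewrite /= !inE !negb_or [e == g]eq_sym ge gf gr.
  rewrite /= cyc andbT (l_inc _ ae ag) 1?eq_sym //=.
  by rewrite (l_inc _ ag af).
move=> b bK; have [->|ba] := eqVneq b a.
  by exists e; rewrite ?mem_head //= eqxx ae.
have [e' e'c /andP[be' bf']] := pc b bK.
(* If the pair of [b] were the broken one, [e] and its successor [f] would share both [a] and [b],
   hence coincide, against irreflexivity of [l]. *)
have [Ee|e'e] := eqVneq e' e.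
  rewrite Ee /= eqxx in be' bf'.
  by move: aef; rewrite (inc_eq2 ba be' ae bf' af) l_irr.
have e'g : e' != g by apply: contraNneq gc => <-.
(* An old entry other than [e] keeps its successor, even the last one, since the head is still
   [e]. *)
exists e'; first by move: e'c; rewrite !in_cons (negbTE e'e) => /= ->; rewrite orbT.
by move: bf'; rewrite /= (negbTE e'e) (negbTE e'g) be'.
Qed.

End Insertion.

(** * Cliques meeting every edge of an arbitrary graph *)

Section CliqueCover.
Variable G : sgraph.
Implicit Types (x y a : G) (e f g : edge G) (c : seq (edge G)) (s K : seq G).

Definition clique s :=
  forall x y, x \in s -> y \in s -> x != y -> adj x y.

Definition edge_cover K := forall e, exists2 a, a \in K & a \in val e.

Definition incident x e := x \in val e.

Lemma adj_neq x y : adj x y -> x != y.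
Proof. by move=> h; apply/eqP => E; rewrite E adj_irrefl in h. Qed.

Lemma is_edge_pair x y : adj x y -> is_edge [set x; y].
Proof. by move=> h; apply/existsP; exists x; apply/existsP; exists y; rewrite h eqxx. Qed.

Lemma card_edge e : #|val e| = 2.
Proof.
case/existsP: (valP e) => x /existsP[y /andP[/adj_neq xy /eqP ->]].
by rewrite cards2 xy.
Qed.

Lemma edge_eq2 e f x y :
  x != y -> x \in val e -> y \in val e -> x \in val f -> y \in val f -> e = f.
Proof.
move=> xy xe ye xf yf; apply: val_inj.
have eqxy g : x \in val g -> y \in val g -> val g = [set x; y].
  move=> xg yg; apply/esym/eqP; rewrite eqEcard card_edge cards2 xy leqnn andbT.
  by rewrite subUset !sub1set xg.
exact: etrans (eqxy e xe ye) (esym (eqxy f xf yf)).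
Qed.

Lemma line_adj_share e f x :
  e != f -> x \in val e -> x \in val f -> line_adj e f.
Proof. by move=> ef xe xf; rewrite /line_adj ef; apply/existsP; exists x; rewrite xe. Qed.

(** The cycle consists of the edges [[set x; next s x]]: consecutive ones share [next s x], and [a]
    lies on those attached to [prev s a] and [a]. *)
Lemma clique_line_cycle s : uniq s -> (2 < size s)%N -> clique s ->
  exists c, [/\ ucycle (@line_adj G) c, size c = size s & passes_through incident s c].
Proof.
move=> us s3 cl.
have nin x : (next s x \in s) = (x \in s) by apply: mem_next.
have nn x : x \in s -> next s (next s x) != x by apply: next_next_neq.
have nx x : x \in s -> x != next s x.
  by move=> xs; apply/eqP => E; have := nn _ xs; rewrite -E -E eqxx.
have adjn x : x \in s -> adj x (next s x).
  by move=> xs; apply: cl; rewrite ?nin ?nx.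
have [x0 x0s] : exists x, x \in s.
  by case: s s3 {us cl nin nn nx adjn} => // x s _; exists x; rewrite mem_head.
(* [e0] is only a default making [E] total; it is never the fallback on [s]. *)
pose e0 : edge G := Sub _ (is_edge_pair (adjn _ x0s)).
pose E x : edge G := insubd e0 [set x; next s x].
have vE x : x \in s -> val (E x) = [set x; next s x].
  by move=> xs; rewrite val_insubd is_edge_pair // adjn.
have Einj : {in s &, injective E}.
  move=> x y xs ys /(congr1 val); rewrite !vE // => /setP exy.
  have := exy x; have := exy (next s x); rewrite !inE !eqxx ?orbT.
  (* Two cases survive, both with [x = next s y]: [next s x = y] contradicts [nn], and
     [next s x = next s y] is settled by injectivity of [next s]. *)
  move=> /esym/orP[/eqP h1|/eqP h1] /esym/orP[/eqP h2|/eqP h2] //.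
    by have := nn _ ys; rewrite -h2 h1 eqxx.
  by apply: (can_inj (prev_next us)).
have uE : uniq (map E s) by rewrite map_inj_in_uniq.
exists (map E s); rewrite size_map; split=> //.
  rewrite /ucycle uE andbT; apply: cycle_next_rel => // _ /mapP[x xs ->].
  rewrite next_map_in //; apply: (@line_adj_share _ _ (next s x)).
  - apply/eqP => /Einj; rewrite nin => /(_ xs xs) h.
    by have := nx _ xs; rewrite -h eqxx.
  - by rewrite vE // !inE eqxx orbT.
  - by rewrite vE ?nin // !inE eqxx.
move=> a as_; have ps : prev s a \in s by rewrite mem_prev.
exists (E (prev s a)); first exact: map_f.
by rewrite /incident next_map_in // next_prev // !vE // next_prev // !inE eqxx orbT.
Qed.

Lemma line_graph_pancyclic K : uniq K -> (2 < size K)%N -> clique K ->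
  edge_cover K -> pancyclic (line_graph G).
Proof.
move=> uK K3 clK cov.
(* Short lengths: a prefix of a clique is a clique. *)
have small k : (2 < k <= size K)%N -> has_cycle (line_graph G) k.
  move=> /andP[k3 kK]; split=> //.
  have sz : size (take k K) = k by rewrite size_takel.
  have [||x y /mem_take xK /mem_take yK|c [uc sc _]] := @clique_line_cycle (take k K).
  - exact: take_uniq.
  - by rewrite sz.
  - exact: clK.
  by exists c; rewrite sc.
(* Long lengths: [passes_through] is carried along so that a further insertion stays possible. *)
have large k : (size K <= k <= #|line_graph G|)%N -> exists c,
    [/\ ucycle (@line_adj G) c, size c = k & passes_through incident K c].
  elim: k => [|k IH]; first by move: K3; case: (size K).
  rewrite leq_eqVlt => /andP[/orP[/eqP <- _|kK kG]].
    exact: clique_line_cycle.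
  have [|c [uc sc pc]] := IH; first by rewrite -ltnS kK ltnW.
  have [g gc] : exists g, g \notin c.
    (* If [c] contained every edge, the order of the line graph would be at most [size c = k]. *)
    apply/existsP; rewrite -negb_forall; apply: contraL kG => /forallP h.
    rewrite -leqNgt -sc; apply: leq_trans (card_size c).
    by apply/subset_leq_card/subsetP => g _; apply: h.
  rewrite -sc; apply: insert_edge (cov g) uc pc gc.
  - exact: line_adj_irrefl.
  - exact: line_adj_share.
  - exact: edge_eq2.
  by rewrite sc; rewrite ltnS in kK; apply: leq_trans kK; apply: ltnW.
split=> [|k /andP[k3 kG]].
  have [c [/andP[_ uc] sc _]] := clique_line_cycle uK K3 clK.
  by rewrite (leq_trans K3) // -sc -(card_uniqP uc) max_card.
have [kK|/ltnW Kk] := leqP k (size K); first by apply: small; rewrite k3.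
by split=> //; have [|c [uc sc _]] := large k; [rewrite Kk | exists c].
Qed.

End CliqueCover.

(** * Sums of two squares and powers of 2 *)

Local Open Scope ring_scope.

(** Transfers the work to integer lifts: divisibility by [4 ^ m] is invisible modulo [2 ^ m]. *)
Lemma Zp_int_eq0 (n : nat) (z : int) : (1 < n)%N ->
  (z%:~R == 0 :> 'Z_n) = (n %| z)%Z.
Proof.
move=> n1; have natE (k : nat) : (k%:R == 0 :> 'Z_n) = (n %| k)%N.
  by rewrite -val_eqE /= val_Zp_nat // /dvdn.
case: z => k; first by rewrite -pmulrn natE.
by rewrite NegzE mulrNz oppr_eq0 -pmulrn natE dvdzE abszN.
Qed.

(** Squares are 0 or 1 modulo 4, so a single odd term already leaves remainder 1 or 2. *)
Lemma dvd4_sum_sqr (u v : int) : (4 %| u ^+ 2 + v ^+ 2)%Z ->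
  (2 %| u)%Z /\ (2 %| v)%Z.
Proof.
rewrite {1}(divz_eq u 2) {1}(divz_eq v 2).
have := ltz_pmod u (isT : 0 < 2 :> int); have := modz_ge0 u (isT : 2 != 0 :> int).
have := ltz_pmod v (isT : 0 < 2 :> int); have := modz_ge0 v (isT : 2 != 0 :> int).
rewrite -!(rwP dvdz_mod0P).
move: (u %/ 2)%Z (v %/ 2)%Z (u %% 2)%Z (v %% 2)%Z => p q r t t0 t2 r0 r2.
have -> : (p * 2 + r) ^+ 2 + (q * 2 + t) ^+ 2 =
    4 * (p ^+ 2 + p * r + q ^+ 2 + q * t) + (r ^+ 2 + t ^+ 2) by ring.
move: (_ + q * t) => w.
have [->|->] : r = 0 \/ r = 1 by lia.
all: have [->|->] : t = 0 \/ t = 1 by lia.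
all: rewrite ?expr0n ?expr1n /=; lia.
Qed.

(** Descent: both numbers are even, and halving them removes one factor 4 from the sum. *)
Lemma dvd_sum_sqr_pow2 (m : nat) (u v : int) :
  ((4 ^ m)%N %| u ^+ 2 + v ^+ 2)%Z -> ((2 ^ m)%N %| u)%Z /\ ((2 ^ m)%N %| v)%Z.
Proof.
elim: m u v => [|m IH] u v; first by rewrite !dvd1z.
move=> h; have [|/dvdzP[u' Eu] /dvdzP[v' Ev]] := @dvd4_sum_sqr u v.
  by apply: dvdz_trans h; rewrite dvdzE /= expnS dvdn_mulr.
rewrite {}Eu {}Ev in h *.
have [|hu hv] := IH u' v'; last by rewrite !expnSr !PoszM !dvdz_mul2r ?hu ?hv.
move: h; have -> : (u' * 2) ^+ 2 + (v' * 2) ^+ 2 = (u' ^+ 2 + v' ^+ 2) * 4 :> int by ring.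
by rewrite expnSr PoszM dvdz_mul2r.
Qed.

(** The 2-adic valuations add up to at least [2 * m], so one of them is at least [m]; zero, which
    has no valuation, is treated apart. *)
Lemma pow2_dvd_mul (m x y : nat) :
  (2 ^ (m + m) %| x * y -> (2 ^ m %| x) || (2 ^ m %| y))%N.
Proof.
case: x => [|x]; first by rewrite dvdn0.
case: y => [|y]; first by rewrite dvdn0 orbT.
rewrite !pfactor_dvdn // lognM //; lia.
Qed.

(** * The norm on the Gaussian integers modulo [2 ^ m] *)

Section GaussNorm.
Variable m : nat.
Hypothesis hm : (2 <= m)%N.
Local Notation R := (gaussZ (2 ^ m)).
Implicit Types x y : R.

Let n_gt1 : (1 < 2 ^ m)%N.
Proof. by rewrite -{1}(expn0 2) ltn_exp2l // ltnW. Qed.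

Definition gnorm x : 'Z_(2 ^ m) := gre x ^+ 2 + gim x ^+ 2.

Definition zre x : int := (gre x : nat)%:Z.
Definition zim x : int := (gim x : nat)%:Z.
Definition znorm x : int := zre x ^+ 2 + zim x ^+ 2.

Lemma greE x : gre x = (zre x)%:~R.
Proof. by rewrite -pmulrn natr_Zp. Qed.
Lemma gimE x : gim x = (zim x)%:~R.
Proof. by rewrite -pmulrn natr_Zp. Qed.

Lemma gnorm_eq0 x : (gnorm x == 0) = ((2 ^ m)%N %| znorm x)%Z.
Proof. by rewrite -Zp_int_eq0 // /gnorm greE gimE rmorphD !rmorphXn. Qed.

Lemma gaussZ_eq0 x : (x == 0) = (gre x == 0) && (gim x == 0).
Proof.
apply/eqP/andP => [-> //|]; case: x => a b /= [/eqP -> /eqP ->] //.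
Qed.

Lemma gmul_eq0 x y : (x * y == 0) =
  ((2 ^ m)%N %| zre x * zre y - zim x * zim y)%Z &&
  ((2 ^ m)%N %| zre x * zim y + zim x * zre y)%Z.
Proof.
rewrite gaussZ_eq0 -!Zp_int_eq0 // rmorphB rmorphD !rmorphM /=.
by rewrite -!greE -!gimE.
Qed.

(** The Brahmagupta-Fibonacci identity, with the coordinates of the product left unreduced. *)
Lemma znormM x y : (zre x * zre y - zim x * zim y) ^+ 2 +
  (zre x * zim y + zim x * zre y) ^+ 2 = znorm x * znorm y.
Proof. rewrite /znorm; ring. Qed.

Lemma gnorm0_mul x y : gnorm x = 0 -> gnorm y = 0 -> x * y = 0.
Proof.
move=> /eqP; rewrite gnorm_eq0 => hx /eqP; rewrite gnorm_eq0 => hy.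
apply/eqP; rewrite gmul_eq0; apply/andP/dvd_sum_sqr_pow2.
by rewrite znormM -[4%N]/(2 * 2)%N expnMn PoszM dvdz_mul.
Qed.

Lemma mul0_gnorm x y : x * y = 0 -> (gnorm x == 0) || (gnorm y == 0).
Proof.
move=> /eqP; rewrite gmul_eq0 => /andP[hu hv].
rewrite !gnorm_eq0 !dvdzE; apply: pow2_dvd_mul; rewrite -abszM -znormM.
(* Reads divisibility of the absolute value as divisibility in the integers, where [rpredD]
   applies. *)
change ((2 ^ (m + m))%N %| (zre x * zre y - zim x * zim y) ^+ 2 +
  (zre x * zim y + zim x * zre y) ^+ 2)%Z.
by rewrite expnD PoszM !expr2 rpredD // dvdz_mul.
Qed.

(** Such an [x] annihilates itself. *)
Lemma gnorm0_zero_divisor x : x != 0 -> gnorm x = 0 -> zero_divisor x.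
Proof.
by move=> x0 hx; apply/existsP; exists x; rewrite x0 gnorm0_mul ?eqxx.
Qed.

(** A nonzero element of square zero: [2 * (m - 1) >= m] because [m >= 2]. *)
Let h : 'Z_(2 ^ m) := (2 ^ m.-1)%:R.

Let h_neq0 : h != 0.
Proof.
rewrite /h -[_%:R]/((2 ^ m.-1)%N%:~R) Zp_int_eq0 // dvdzE /=.
by rewrite gtnNdvd // ?expn_gt0 // ltn_exp2l //; lia.
Qed.

Let hh : h ^+ 2 = 0.
Proof.
apply/eqP; rewrite /h -natrX -expnM -[_%:R]/((2 ^ (m.-1 * 2))%N%:~R).
by rewrite Zp_int_eq0 // dvdzE /= dvdn_exp2l //; lia.
Qed.

Local Notation Gamma := (zero_divisor_graph R).

Definition norm0_vertices : {set Gamma} := [set x : Gamma | gnorm (val x) == 0].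

Lemma card_norm0_vertices : (2 < #|norm0_vertices|)%N.
Proof.
pose v (a b : 'Z_(2 ^ m)) : R := GaussZ a b.
have E (a b : 'Z_(2 ^ m)) : a ^+ 2 + b ^+ 2 = 0 -> (a != 0) || (b != 0) ->
    exists2 w : Gamma, w \in norm0_vertices & val w = v a b.
  move=> nab ab; have v0 : v a b != 0 by rewrite gaussZ_eq0 negb_and.
  have zv : (v a b != 0) && zero_divisor (v a b).
    by rewrite v0 gnorm0_zero_divisor.
  by exists (Sub (v a b) zv : zdvertex R); rewrite ?inE //= /gnorm /= nab.
(* The three vertices are [h], [h * i] and [h + h * i]; they are distinct because [h] is nonzero. *)
have [||p pK vp] := E h 0; rewrite ?h_neq0 ?hh ?expr0n ?addr0 //.
have [||q qK vq] := E 0 h; rewrite ?h_neq0 ?orbT ?hh ?expr0n ?add0r //.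
have [||r rK vr] := E h h; rewrite ?h_neq0 ?hh ?addr0 //.
rewrite cardE; apply: (@uniq_leq_size _ [:: p; q; r]); last first.
  by move=> w; rewrite mem_enum 2!in_cons mem_seq1 => /or3P[]/eqP->.
rewrite /= !inE -!val_eqE /= vp vq vr /v andbT negb_or -andbA.
by apply/and3P; split; apply/eqP => -[] /eqP; rewrite ?(eq_sym 0) (negbTE h_neq0).
Qed.

Lemma norm0_clique : clique (enum norm0_vertices).
Proof.
move=> x y; rewrite !mem_enum !inE => /eqP hx /eqP hy xy.
by rewrite /= /zdadj xy gnorm0_mul ?eqxx.
Qed.

Lemma norm0_edge_cover : edge_cover (enum norm0_vertices).
Proof.
move=> e; case/existsP: (valP e) => x /existsP[y /andP[/andP[_ /eqP xy] /eqP ->]].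
by case/orP: (mul0_gnorm xy) => h0; [exists x | exists y];
  rewrite ?mem_enum !inE ?eqxx ?orbT.
Qed.

End GaussNorm.

Theorem theorem3p7 (m : nat) (hm : (2 <= m)%N) :
  pancyclic (line_graph (zero_divisor_graph (gaussZ (2 ^ m)))).
Proof.
apply: (@line_graph_pancyclic _ (enum (norm0_vertices m))).
- exact: enum_uniq.
- by rewrite -cardE card_norm0_vertices.
- exact: norm0_clique.
- exact: norm0_edge_cover.
Qed.
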